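(* Let $n,k,t$ be positive integers with $t\ge n$, $\frac{n(n+1)}{2}=k\cdot t$, $n$ even and $2k\mid n$. The algorithm $\mathtt{meandereven}(n,k,t)$ (a) outputs sets $T_1,\dots,T_k$ that form a $(k,t)$-partition of $\{1,\dots,n\}$, i.e. they are pairwise disjoint, their union is $\{1,\dots,n\}$ and $\sum_{x\in T_j}x=t$ for each $j$; and (b) needs $\mathcal{O}(n)$ steps to insert the $n$ elements of $\{1,\dots,n\}$ into the sets $T_j$.
   Context: $\mathtt{meandereven}(n,k,t)$: start with $T_j=\emptyset$ for $1\le j\le k$; for $j=1,\dots,k$ and for $i=1,\dots,\frac{n}{2k}$, insert the element $2ki-(j-1)$ and the element $2k(i-1)+j$ into $T_j$. *)

(* Defs.v *)
(* World: MathComp, with mathcomp-finmap for the sets T_j. *)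
From mathcomp Require Import all_boot finmap.

Set Implicit Arguments.
Unset Strict Implicit.
Unset Printing Implicit Defensive.

(* A small imperative language with a uniform-cost semantics, so that the
   number of steps is a property of executing the program text. *)

Variant var := vn | vk | vt | vi | vj.

Scheme Boolean Equality for var.

Inductive expr :=
  | Cst of nat
  | Var of var
  | Add of expr & expr
  | Sub of expr & expr
  | Mul of expr & expr
  | Div of expr & expr.

Coercion Cst : nat >-> expr.
Coercion Var : var >-> expr.

Declare Scope expr_scope.
Delimit Scope expr_scope with E.
Bind Scope expr_scope with expr.
Notation "a + b" := (Add a b) : expr_scope.
Notation "a - b" := (Sub a b) : expr_scope.
Notation "a * b" := (Mul a b) : expr_scope.
Notation "a / b" := (Div a b) : expr_scope.

(* [MakeEmpty j] is T_j := {}; [Insert x j] inserts x into T_j;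
   [For v lo hi c] runs c for v = lo, lo + 1, ..., hi (bounds included and
   evaluated once, on entry). *)
Inductive cmd :=
  | MakeEmpty of expr
  | Insert of expr & expr
  | Seq of cmd & cmd
  | For of var & expr & expr & cmd.

Record memory := Memory {
  scalar : var -> nat;
  family : nat -> {fset nat}
}.

Definition set_scalar (m : memory) (v : var) (x : nat) : memory :=
  Memory (fun w => if var_beq w v then x else scalar m w) (family m).

Definition set_family (m : memory) (j : nat) (A : {fset nat}) : memory :=
  Memory (scalar m) (fun l => if l == j then A else family m l).

(* Subtraction is truncated and division is Euclidean; on the inputs considered
   below every difference is nonnegative and every quotient exact. *)
Fixpoint eval (m : memory) (e : expr) : nat :=
  match e with
  | Cst c => c
  | Var v => scalar m v
  | Add a b => eval m a + eval m b
  | Sub a b => eval m a - eval m b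
  | Mul a b => eval m a * eval m b
  | Div a b => eval m a %/ eval m b
  end.

(* One step per constant, variable access and arithmetic operation. *)
Fixpoint eval_steps (e : expr) : nat :=
  match e with
  | Cst _ | Var _ => 1
  | Add a b | Sub a b | Mul a b | Div a b => (eval_steps a + eval_steps b).+1
  end.

(* Final memory and number of steps.  Besides the evaluation of its arguments,
   emptying a set and inserting an element into a set cost one step each.  A
   loop costs two steps per iteration (test and update of the counter), plus
   one for the final, failing test. *)
Fixpoint exec (c : cmd) (m : memory) : memory * nat :=
  match c with
  | MakeEmpty j => (set_family m (eval m j) fset0, (eval_steps j).+1)
  | Insert x j =>
      (set_family m (eval m j) (eval m x |` family m (eval m j))%fset,
       (eval_steps x + eval_steps j).+1)
  | Seq c1 c2 =>
      let r1 := exec c1 m in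
      let r2 := exec c2 r1.1 in
      (r2.1, r1.2 + r2.2)
  | For v lo hi body =>
      let a := eval m lo in
      let b := eval m hi in
      foldl (fun r x =>
               let r' := exec body (set_scalar r.1 v x) in
               (r'.1, r.2 + r'.2 + 2))
            (m, (eval_steps lo + eval_steps hi).+1)
            (iota a (b.+1 - a))
  end.

Definition meandereven : cmd :=
  Seq
    (For vj 1 vk (MakeEmpty vj))
    (For vj 1 vk
      (For vi 1 (vn / (2 * vk))
        (Seq
          (Insert (2 * vk * vi - (vj - 1)) vj)
          (Insert (2 * vk * (vi - 1) + vj) vj)))).

(* [T0] is the arbitrary content of the sets before the run. *)
Definition input (T0 : nat -> {fset nat}) (n k t : nat) : memory :=
  Memory (fun v => match v with vn => n | vk => k | vt => t | vi | vj => 0 end)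
         T0.

Definition meandereven_output (T0 : nat -> {fset nat}) (n k t : nat) :
    nat -> {fset nat} :=
  family (exec meandereven (input T0 n k t)).1.

Definition meandereven_steps (T0 : nat -> {fset nat}) (n k t : nat) : nat :=
  (exec meandereven (input T0 n k t)).2.

(* Only T_1, ..., T_k matter; the values of T at other indices are junk. *)
Definition kt_partition (n k t : nat) (T : nat -> {fset nat}) : Prop :=
  [/\ forall i j : nat, 1 <= i <= k -> 1 <= j <= k -> i <> j ->
        [disjoint T i & T j]%fset,
      (\bigcup_(j <- iota 1 k) T j)%fset = [fset x | x in iota 1 n]%fset
    & forall j : nat, 1 <= j <= k -> \sum_(x <- T j) x = t].

(* Main.v *)
(* Cut {1, ..., n} into consecutive blocks of length 2k.  The algorithm colours
   each block 1, 2, ..., k, k, ..., 2, 1, and T_j receives the elements of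
   colour j; this gives disjointness and covering.  The two elements of colour j
   in a block are symmetric about its centre, so all colours have the same
   sum in every block. *)
Require Import Defs.
From mathcomp Require Import all_boot finmap.
From mathcomp Require Import zify.

Set Implicit Arguments.
Unset Strict Implicit.
Unset Printing Implicit Defensive.

Lemma exec_For_ind (I : nat -> memory * nat -> Prop) v (hi : expr) body m :
  I 0 (m, (eval_steps hi).+2) ->
  (forall x r, x < eval m hi -> I x r ->
     let r' := exec body (set_scalar r.1 v x.+1) in
     I x.+1 (r'.1, r.2 + r'.2 + 2)) ->
  I (eval m hi) (exec (For v 1 hi body) m).
Proof.
move=> I0 IS; rewrite [exec _ _]/= subn1 succnK add1n.
have: eval m hi <= eval m hi by [].
elim: {1 3 4}(eval m hi) => [|x IHx] ltx //.
by rewrite -addn1 iotaD foldl_cat addn1; apply: IS => //; apply/IHx/ltnW.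
Qed.

Definition colour (k x : nat) : nat :=
  let b := (x.-1) %% (2 * k) in if b < k then b.+1 else 2 * k - b.

Definition colour_class (k j q : nat) : {fset nat} :=
  [fset x in iota 1 (2 * k * q) | colour k x == j]%fset.

Lemma in_colour_class k j q x :
  (x \in colour_class k j q) = (0 < x <= 2 * k * q) && (colour k x == j).
Proof. by rewrite !inE /= mem_iota add1n ltnS. Qed.

Lemma colour_range k x : 0 < k -> 1 <= colour k x <= k.
Proof.
move=> k0; rewrite /colour; have := ltn_pmod x.-1 (_ : 0 < 2 * k).
by case: ifP; lia.
Qed.

Lemma colour_block k q b : b < 2 * k ->
  colour k (2 * k * q + b).+1 = if b < k then b.+1 else 2 * k - b.
Proof. by move=> lt_b; rewrite /colour succnK mulnC modnMDl modn_small. Qed.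

Lemma colour_classS k j q : 1 <= j <= k ->
  colour_class k j q.+1 =
  ((2 * k * q + j)%N |` ((2 * k * q.+1 - (j - 1))%N |` colour_class k j q))%fset.
Proof.
move=> jk; apply/fsetP => x; rewrite !in_fset1U !in_colour_class.
case: (leqP x (2 * k * q)) => [le_x|lt_x]; first by lia.
case: (leqP x (2 * k * q.+1)) => [le_x|]; last by lia.
have -> : x = (2 * k * q + (x - (2 * k * q).+1)).+1 by lia.
by rewrite colour_block; [case: ifP; lia | lia].
Qed.

Lemma sum_colour_class k j q : 1 <= j <= k ->
  \sum_(x <- colour_class k j q) x = q * (2 * k * q + 1).
Proof.
move=> jk; elim: q => [|q IHq].
  suff -> : colour_class k j 0 = fset0 by rewrite big_seq_fset0.
  by apply/fsetP => x; rewrite in_colour_class inE; lia.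
rewrite colour_classS // !big_fsetU1 /= ?IHq.
- by nia.
- by rewrite in_colour_class; lia.
- by rewrite in_fset1U in_colour_class; lia.
Qed.

Lemma kt_partition_colour_class k m T : 0 < k ->
  (forall j, 1 <= j <= k -> T j = colour_class k j m) ->
  kt_partition (2 * k * m) k (m * (2 * k * m + 1)) T.
Proof.
move=> k0 defT; split=> [i j ik jk ij||j jk]; last first.
- by rewrite defT // sum_colour_class.
- apply/fsetP => x; rewrite !inE /= mem_iota.
  apply/bigfcupP/idP => [[j /andP[]]|xn].
    by rewrite mem_iota => jk _; rewrite defT ?in_colour_class; lia.
  have ck := colour_range x k0.
  exists (colour k x); first by rewrite mem_iota andbT; lia.
  by rewrite defT // in_colour_class eqxx; lia.
apply/fdisjointP => x; rewrite !defT // !in_colour_class => /andP[-> /eqP->].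
by apply/eqP.
Qed.

Definition meander_row : cmd :=
  For vi 1 (vn / (2 * vk))%E
    (Seq
      (Insert (2 * vk * vi - (vj - 1))%E vj)
      (Insert (2 * vk * (vi - 1) + vj)%E vj)).

Lemma exec_meander_row k m j M :
  scalar M vn = 2 * k * m -> scalar M vk = k -> scalar M vj = j ->
  1 <= j <= k -> Defs.family M j = fset0 ->
  let r := exec meander_row M in
  [/\ scalar r.1 vn = 2 * k * m, scalar r.1 vk = k,
      forall l, Defs.family r.1 l =
        if l == j then colour_class k j m else Defs.family M l
    & r.2 = 7 + 24 * m].
Proof.
move=> Mn Mk Mj jk Mj0 r.
have hiE : eval M (vn / (2 * vk))%E = m by rewrite /= Mn Mk mulKn; lia.
pose I q (r : memory * nat) :=
  [/\ scalar r.1 vn = 2 * k * m /\ scalar r.1 vk = k, scalar r.1 vj = j,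
      forall l, Defs.family r.1 l =
        if l == j then colour_class k j q else Defs.family M l
    & r.2 = 7 + 24 * q].
suff [[]] : I m r by [].
rewrite -[X in I X _]hiE; apply: exec_For_ind.
  split=> //= l; case: eqP => // ->; rewrite Mj0.
  by apply/fsetP => x; rewrite in_colour_class inE; lia.
move=> q [M' s] _ [/= [M'n M'k] M'j M'T ->]; split=> //=; last by lia.
move=> l; rewrite M'j M'k eqxx !M'T eqxx.
by case: eqP => // _; rewrite colour_classS // subn1 succnK.
Qed.

Lemma exec_meandereven T0 k m t : 0 < k ->
  let r := exec meandereven (input T0 (2 * k * m) k t) in
  (forall j, 1 <= j <= k -> Defs.family r.1 j = colour_class k j m)
  /\ r.2 = 6 + 13 * k + 24 * (k * m).
Proof.
move=> k0; set M := input _ _ _ _.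
pose I q (r : memory * nat) :=
  [/\ scalar r.1 vn = 2 * k * m, scalar r.1 vk = k,
      forall l, 1 <= l <= q -> Defs.family r.1 l = fset0 & r.2 = 3 + 4 * q].
have : I (eval M vk) (exec (For vj 1 vk (MakeEmpty vj)) M).
  apply: exec_For_ind; first by split=> //= l; lia.
  move=> q [M' s] _ [/= M'n M'k M'0 ->]; split=> //=; last by lia.
  by move=> l lq; case: eqP => // lq'; apply: M'0; lia.
rewrite /meandereven -/meander_row.
move: meander_row (@exec_meander_row) => row rowP /=.
case: (foldl _ _ _) => M1 s1 [/= M1n M1k M10 ->].
pose J q (r : memory * nat) :=
  [/\ scalar r.1 vn = 2 * k * m, scalar r.1 vk = k,
      forall l, 1 <= l <= k ->
        Defs.family r.1 l = if l <= q then colour_class k l m else fset0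
    & r.2 = 3 + q * (9 + 24 * m)].
have : J (eval M1 vk) (exec (For vj 1 vk row) M1).
  apply: exec_For_ind.
    by split=> //= l lk; rewrite M10 //; case: ifP => //; lia.
  move=> q [M' s]; rewrite [eval _ _]M1k => qk [/= M'n M'k M'T ->].
  have qk' : 1 <= q.+1 <= k by [].
  have [] := rowP k m q.+1 (set_scalar M' vj q.+1) _ _ _ qk' _ => //.
    by rewrite /= M'T // ltnn.
  move=> r'n r'k r'T r's; split=> //=; last by rewrite r's; lia.
  move=> l lk; rewrite r'T /= [l <= q.+1]leq_eqVlt ltnS.
  by case: eqP => [->//|_] /=; apply: M'T.
rewrite /= M1k => -[_ _ rT ->]; split; last by nia.
by move=> j jk; rewrite rT //; case/andP: jk => _ ->.
Qed.

Theorem theorem1 :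
  (forall (T0 : nat -> {fset nat}) (n k t : nat),
     0 < n -> 0 < k -> 0 < t -> n <= t ->
     (n * (n + 1)) %/ 2 = k * t -> ~~ odd n -> 2 * k %| n ->
     kt_partition n k t (meandereven_output T0 n k t))
  /\
  (exists C : nat, forall (T0 : nat -> {fset nat}) (n k t : nat),
     0 < n -> 0 < k -> 0 < t -> n <= t ->
     (n * (n + 1)) %/ 2 = k * t -> ~~ odd n -> 2 * k %| n ->
     meandereven_steps T0 n k t <= C * n).
Proof.
split.
  move=> T0 n k t _ k0 _ _ sum_n _ /dvdnP[m]; rewrite mulnC => def_n.
  subst n; have -> : t = m * (2 * k * m + 1).
    apply/eqP; rewrite -(eqn_pmul2l k0) -sum_n -!mulnA mulKn //; apply/eqP; lia.
  by apply: kt_partition_colour_class; last case: (exec_meandereven T0 m (m * (2 * k * m + 1)) k0).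
exists 31 => T0 n k t n0 k0 _ _ _ _ /dvdnP[m]; rewrite mulnC => def_n.
subst n; rewrite /meandereven_steps; case: (exec_meandereven T0 m t k0) => _ ->.
have km : k <= k * m by rewrite leq_pmulr //; case: m n0; lia.
by rewrite -mulnA; lia.
Qed.
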